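(* Let $\mathbb H=(A,\prec,\mathcal C)$ be an sp-algebra with $\mathcal C\subseteq\mathcal C_\prec$, such that $A$ is a Heyting algebra and $\mathbb H$ is $\mathrm{(X)}$-updirected for every $\mathrm{(X)}\in\{\mathrm{(SI)},\mathrm{(WO)},\mathrm{(AND)},\mathrm{(OR)}\}$. Let $S=S(\prec,\mathcal C)$ be the relation $S^{\mathrm{(SI)},\mathrm{(WO)},\mathrm{(AND)},\mathrm{(OR)}}(\prec,\mathcal C)$ and, in the canonical extension $A^\delta$, let $\blacksquare_sb=\bigvee\{a\in A\mid a\,S\,b\}$ and $\blacksquare c=\bigvee\{a\in A\mid a\prec c\}$. Then the following are equivalent: (a) (cross-coherence) for all $a,b,c\in A$, if $a\,S\,b$, $a\prec c$ and $b\wedge c\le\bot$, then $a\le\bot$; (b) $\blacksquare_s(c\to\bot)\wedge\blacksquare c\le\bot$ in $A^\delta$ for all $c\in A$.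
   Context: Canonical extension. For a poset $A$, $A^\delta$ is a complete lattice containing $A$ as a subposet. $k\in A^\delta$ is closed if $k=\bigwedge F$ for some nonempty down-directed $F\subseteq A$; $o$ is open if $o=\bigvee I$ for some nonempty up-directed $I\subseteq A$. Denseness: every element of $A^\delta$ is a join of closed elements and a meet of open elements. Compactness: if $F\subseteq A$ is nonempty down-directed, $I\subseteq A$ nonempty up-directed and $\bigwedge F\le\bigvee I$, then $a\le b$ for some $a\in F$, $b\in I$. $A^\delta$ exists and is unique up to isomorphism fixing $A$; if $A$ is a distributive lattice then $A^\delta$ is completely distributive. Conditions on a binary relation $R$ on $A$: (SI) $a\le b\ \&\ b\,R\,x\Rightarrow a\,R\,x$; (WO) $b\,R\,x\ \&\ x\le y\Rightarrow b\,R\,y$; (AND) $a\,R\,x\ \&\ a\,R\,y\Rightarrow a\,R\,(x\wedge y)$; (OR) $a\,R\,x\ \&\ b\,R\,x\Rightarrow(a\vee b)\,R\,x$. An sp-algebra is $(A,\prec,\mathcal C)$, with $A$ a bounded lattice, such that $\prec$ satisfies $\bot\prec\bot$, $\top\prec\top$, (SI), (WO), (AND), (OR), and $\overline{\mathcal C}=(A\times A)\setminus\mathcal C$ satisfies $\bot\,\overline{\mathcal C}\,\top$; $\top\,\overline{\mathcal C}\,\bot$; $b\,\overline{\mathcal C}\,c\ \&\ a\le b\Rightarrow a\,\overline{\mathcal C}\,c$; $a\,\overline{\mathcal C}\,c\ \&\ b\le c\Rightarrow a\,\overline{\mathcal C}\,b$; $a\,\overline{\mathcal C}\,b\ \&\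 a\,\overline{\mathcal C}\,c\Rightarrow a\,\overline{\mathcal C}\,(b\vee c)$; $a\,\overline{\mathcal C}\,c\ \&\ b\,\overline{\mathcal C}\,c\Rightarrow(a\vee b)\,\overline{\mathcal C}\,c$. $A$ is assumed to belong to the class $\mathsf{Alg}(\mathcal L)$ of a fixed (fully) selfextensional logic $\mathcal L=(\mathrm{Fm},\vdash)$. An $\mathcal L$-filter of $A$ is a subset $F\subseteq A$ such that whenever $\Gamma\vdash\varphi$ and $h:\mathrm{Fm}\to A$ is a homomorphism with $h[\Gamma]\subseteq F$, then $h(\varphi)\in F$; $A\in\mathsf{Alg}(\mathcal L)$ means that distinct elements are separated by $\mathcal L$-filters, and $a\le b$ iff every $\mathcal L$-filter containing $a$ contains $b$. $F(b,c)$ is the $\mathcal L$-filter generated by $\{b,c\}$, and $\mathcal C_\prec:=\{(a,b)\mid\forall c\,(a\prec c\Rightarrow F(b,c)\ne A)\}$. For (R) a condition or list of conditions among (SI), (WO), (AND), (OR), $\prec^{\mathrm{(R)}}$ (resp. $\prec^{\mathrm{(R)}}_{(a,b)}$) is the smallest superset of $\prec$ (resp. of $\prec\cup\{(a,b)\}$) satisfying (R), and $S^{\mathrm{(R)}}(\prec,\mathcal C):=\bigcup\{\prec^{\mathrm{(R)}}_{(a,b)}\mid(a,b)\in\mathcal C\}$ if $\mathcal C\ne\varnothing$, and $\prec^{\mathrm{(R)}}$ otherwise. $\mathbb H$ is (R)-updirected if for all $a\,\mathcal C\,b$ and $c\,\mathcal C\,d$ there are $e\,\mathcal C\,f$ with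 $\prec^{\mathrm{(R)}}_{(a,b)}\cup\prec^{\mathrm{(R)}}_{(c,d)}\ \subseteq\ \prec^{\mathrm{(R)}}_{(e,f)}$. *)

(* Defs.v *)
From mathcomp Require Import all_boot all_order.
From mathcomp Require Export boolp classical_sets.

Set Implicit Arguments.
Unset Strict Implicit.
Unset Printing Implicit Defensive.

Import Order.TTheory.
Local Open Scope classical_set_scope.
Local Open Scope order_scope.

(** ** Logics and their algebras *)

Record signature := Signature { symbol : Type; arity : symbol -> nat }.

Definition interp (sg : signature) (T : Type) :=
  forall f : symbol sg, ('I_(arity f) -> T) -> T.

Inductive fm (sg : signature) (V : Type) : Type :=
| Var of V
| App (f : symbol sg) of ('I_(arity f) -> fm sg V).

Definition fm_interp sg V : interp sg (fm sg V) := @App sg V.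

Definition hom sg T U (opT : interp sg T) (opU : interp sg U) (h : T -> U) :=
  forall (f : symbol sg) (x : 'I_(arity f) -> T),
    h (opT f x) = opU f (fun i => h (x i)).

Record logic (sg : signature) (V : Type) := Logic {
  entails :> set (fm sg V) -> fm sg V -> Prop;
  entails_refl : forall Gamma phi, Gamma phi -> entails Gamma phi;
  entails_mono : forall Gamma Delta phi,
    Gamma `<=` Delta -> entails Gamma phi -> entails Delta phi;
  entails_cut : forall Gamma Delta phi,
    (forall psi, Delta psi -> entails Gamma psi) ->
    entails Delta phi -> entails Gamma phi;
  entails_subst : forall (s : fm sg V -> fm sg V) Gamma phi,
    hom (@fm_interp sg V) (@fm_interp sg V) s ->
    entails Gamma phi -> entails (s @` Gamma) (s phi) }.

Definition interderivable sg V (L : logic sg V) (phi psi : fm sg V) :=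
  L [set phi] psi /\ L [set psi] phi.

(* Interderivability, which is always an equivalence relation, is a congruence
   of the formula algebra.  Full selfextensionality (the same condition on the
   L-filters of every algebra, not only of the formula algebra) implies this. *)
Definition selfextensional sg V (L : logic sg V) :=
  forall (f : symbol sg) (x y : 'I_(arity f) -> fm sg V),
    (forall i, interderivable L (x i) (y i)) ->
    interderivable L (App x) (App y).

Section Filters.
Context (sg : signature) (V : Type) (L : logic sg V).
Context (T : Type) (op : interp sg T).

Definition is_filter : set (set T) := [set F |
  forall (Gamma : set (fm sg V)) (phi : fm sg V) (h : fm sg V -> T),
    L Gamma phi -> hom (@fm_interp sg V) op h ->
    h @` Gamma `<=` F -> F (h phi)].

Definition in_Alg :=
  forall a b : T, a <> b -> exists2 F, is_filter F & ~ (F a <-> F b).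

Definition filter_le (a b : T) := forall F, is_filter F -> F a -> F b.

Definition filter_gen (b c : T) : set T := smallest is_filter [set b; c].

(* The relation C_prec induced by prec. *)
Definition compat (prec : set (T * T)) : set (T * T) :=
  [set p | forall c, prec (p.1, c) -> filter_gen p.2 c <> setT].

End Filters.

(** ** Relations on a lattice; a relation R is a set of pairs *)

Section Rules.
Context (d : Order.disp_t) (A : latticeType d).

Definition SI : set (set (A * A)) := [set R |
  forall a b x, a <= b -> R (b, x) -> R (a, x)].
Definition WO : set (set (A * A)) := [set R |
  forall b x y, R (b, x) -> x <= y -> R (b, y)].
Definition AND : set (set (A * A)) := [set R |
  forall a x y, R (a, x) -> R (a, y) -> R (a, x `&` y)].
Definition OR : set (set (A * A)) := [set R |
  forall a b x, R (a, x) -> R (b, x) -> R (a `|` b, x)].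

(* [P] is the set of relations that satisfy the chosen conditions (R). *)
Definition clos (P : set (set (A * A))) (prec : set (A * A)) : set (A * A) :=
  smallest P prec.

Definition clos_with (P : set (set (A * A))) (prec : set (A * A)) (p : A * A) :
  set (A * A) := smallest P (prec `|` [set p])%classic.

Definition Srel (P : set (set (A * A))) (prec C : set (A * A)) : set (A * A) :=
  if C == set0 then clos P prec else \bigcup_(p in C) clos_with P prec p.

Definition updirected (P : set (set (A * A))) (prec C : set (A * A)) :=
  forall p q, C p -> C q ->
    exists2 r, C r &
      (clos_with P prec p `|` clos_with P prec q `<=` clos_with P prec r)%classic.

End Rules.

Record sp_algebra d (A : tbLatticeType d) (prec C : set (A * A)) : Prop := {
  prec_bot : prec (\bot, \bot);
  prec_top : prec (\top, \top);
  prec_SI : SI prec;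
  prec_WO : WO prec;
  prec_AND : AND prec;
  prec_OR : OR prec;
  nC_bot_top : (~` C)%classic (\bot, \top);
  nC_top_bot : (~` C)%classic (\top, \bot);
  nC_downl : forall a b c,
    (~` C)%classic (b, c) -> a <= b -> (~` C)%classic (a, c);
  nC_downr : forall a b c,
    (~` C)%classic (a, c) -> b <= c -> (~` C)%classic (a, b);
  nC_joinr : forall a b c,
    (~` C)%classic (a, b) -> (~` C)%classic (a, c) ->
    (~` C)%classic (a, b `|` c);
  nC_joinl : forall a b c,
    (~` C)%classic (a, c) -> (~` C)%classic (b, c) ->
    (~` C)%classic (a `|` b, c) }.

(* A bounded lattice with such an operation is a Heyting algebra
   (distributivity follows). *)
Definition heyting_imp d (A : tbLatticeType d) (imp : A -> A -> A) :=
  forall a b c : A, (a `&` b <= c) = (a <= imp b c).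

(** ** Canonical extensions *)

Definition complete_lattice d (D : tbLatticeType d) :=
  forall X : set D, supremums X !=set0 /\ infimums X !=set0.

(* In a complete lattice these are the join and the meet of X, including
   X = set0. *)
Definition Join d (D : tbLatticeType d) (X : set D) : D := supremum \bot X.
Definition Meet d (D : tbLatticeType d) (X : set D) : D := infimum \top X.

Definition down_directed d (A : porderType d) (F : set A) :=
  forall a b, F a -> F b -> exists2 c, F c & c <= a /\ c <= b.
Definition up_directed d (A : porderType d) (I : set A) :=
  forall a b, I a -> I b -> exists2 c, I c & a <= c /\ b <= c.

Section CanonicalExtension.
Context (d d' : Order.disp_t) (A : porderType d) (D : tbLatticeType d').
Context (e : A -> D).

Definition closed_elt : set D := [set k |
  exists F : set A, [/\ F !=set0, down_directed F & k = Meet (e @` F)]].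
Definition open_elt : set D := [set o |
  exists I : set A, [/\ I !=set0, up_directed I & o = Join (e @` I)]].

Record canonical_extension : Prop := {
  ce_complete : complete_lattice D;
  ce_embed : {mono e : a b / a <= b};
  ce_dense_closed : forall u, exists2 K, K `<=` closed_elt & u = Join K;
  ce_dense_open : forall u, exists2 O, O `<=` open_elt & u = Meet O;
  ce_compact : forall F I : set A,
    F !=set0 -> down_directed F -> I !=set0 -> up_directed I ->
    Meet (e @` F) <= Join (e @` I) ->
    exists a b, [/\ F a, I b & a <= b] }.

(* For R = prec this is the black box of b, for R = S the black box_s of b. *)
Definition bbox (R : set (A * A)) (b : A) : D := Join (e @` [set a | R (a, b)]).

End CanonicalExtension.

(* Main.v *)
Require Import Defs.
From mathcomp Require Import all_boot all_order.
From mathcomp Require Import boolp classical_sets.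

(** [S] is again closed under (SI), (WO) and (OR): (OR) survives the union over
    [C] because updirectedness for one condition implies updirectedness for all
    four together.  Hence the sets [{a | a S b}] and
    [{a | a prec c}] are nonempty ideals of [A].  By denseness, (b) need only be
    tested on closed elements [k] below both black boxes; compactness then gives
    a single [a] in [A], above [k], with [a S (c -> bot)] and [a prec c], to which
    cross-coherence applies.  Conversely, such an [a] lies below both boxes,
    since [b /\ c <= bot] means [b <= (c -> bot)]. *)

Set Implicit Arguments.
Unset Strict Implicit.
Unset Printing Implicit Defensive.

Import Order.TTheory.
Local Open Scope classical_set_scope.
Local Open Scope order_scope.

Lemma smallest_sub_smallest T (P : set (set T)) (G G' : set T) :
  G `<=` smallest P G' -> smallest P G `<=` smallest P G'.
Proof.
move=> GG' x Gx M [PM G'M]; apply: Gx; split=> // y /GG'.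
by apply; split.
Qed.

Section CompleteLattice.
Context (d : Order.disp_t) (D : tbLatticeType d) (hD : complete_lattice D).
Implicit Types (X : set D) (x u : D).

Lemma le_Join X x : X x -> x <= Join X.
Proof.
rewrite /Join /supremum; case: ifPn => [/eqP->//|_ Xx].
(* [supremum] selects a point of [supremums X] and falls back on a default if there is none;
   completeness rules that case out. *)
have [[s sX] _] := hD X; case: xgetP => [y _ [Xy _]|/(_ s)//].
exact: Xy.
Qed.

Lemma Join_le X u : (forall x, X x -> x <= u) -> Join X <= u.
Proof.
(* For [X = set0] the default [\bot] is below every [u]. *)
move=> Xu; rewrite /Join /supremum; case: ifPn => [_|_]; first exact: le0x.
have [[s sX] _] := hD X; case: xgetP => [y _ [_ yX]|/(_ s)//].
exact: yX.
Qed.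

Lemma Meet_le X x : X x -> Meet X <= x.
Proof.
rewrite /Meet /infimum; case: ifPn => [/eqP->//|_ Xx].
have [_ [s sX]] := hD X; case: xgetP => [y _ [Xy _]|/(_ s)//].
exact: Xy.
Qed.

Lemma le_Meet X u : (forall x, X x -> u <= x) -> u <= Meet X.
Proof.
move=> Xu; rewrite /Meet /infimum; case: ifPn => [_|_]; first exact: lex1.
have [_ [s sX]] := hD X; case: xgetP => [y _ [_ yX]|/(_ s)//].
exact: yX.
Qed.

End CompleteLattice.

Section CanonicalExtensionTheory.
Context (d d' : Order.disp_t) (A : tbLatticeType d) (D : tbLatticeType d').
Context (e : A -> D) (he : canonical_extension e).

(** By denseness [\bot] is a meet of open elements. Each is the join of a nonempty family from [e],
    so it lies above some [e a], hence above [e \bot]. *)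
Lemma canonical_extension_bot : e \bot = \bot.
Proof.
have hD := ce_complete he; apply: le_anti; rewrite le0x andbT.
have [O Oopen ->] := ce_dense_open he \bot.
apply: (le_Meet hD) => o /Oopen[I [[a Ia] _ ->]].
apply: (@le_trans _ _ (e a)); first by rewrite (ce_embed he) le0x.
by apply: (le_Join hD); exists a.
Qed.

Lemma le_bbox (R : set (A * A)) a b : R (a, b) -> e a <= bbox e R b.
Proof. by move=> Rab; apply: (le_Join (ce_complete he)); exists a. Qed.

(** Compactness applies: [\bot] makes the set of [R]-predecessors of [b] nonempty, and (OR) makes it
    up-directed. *)
Lemma Meet_le_bbox (R : set (A * A)) (F : set A) b :
  OR R -> R (\bot, b) -> F !=set0 -> down_directed F ->
  Meet (e @` F) <= bbox e R b -> exists x y, [/\ F x, R (y, b) & x <= y].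
Proof.
move=> ORR R0 F0 Fdir; apply: (ce_compact he) => //; first by exists \bot.
move=> x y Rx Ry; exists (x `|` y); first exact: ORR.
by rewrite leUl leUr.
Qed.

Lemma bbox_meet_le (R1 R2 : set (A * A)) b c u :
  SI R1 -> SI R2 -> OR R1 -> OR R2 -> R1 (\bot, b) -> R2 (\bot, c) ->
  (forall a, R1 (a, b) -> R2 (a, c) -> e a <= u) ->
  bbox e R1 b `&` bbox e R2 c <= u.
Proof.
move=> SI1 SI2 OR1 OR2 R10 R20 Ru; have hD := ce_complete he.
have [K Kclosed KE] := ce_dense_closed he (bbox e R1 b `&` bbox e R2 c).
rewrite KE; apply: (Join_le hD) => k Kk.
have : k <= bbox e R1 b `&` bbox e R2 c by rewrite KE; apply: (le_Join hD).
have [F [F0 Fdir ->]] := Kclosed _ Kk; rewrite lexI => /andP[].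
move=> /(Meet_le_bbox OR1 R10 F0 Fdir)[x1 [y1 [Fx1 Ry1 xy1]]].
move=> /(Meet_le_bbox OR2 R20 F0 Fdir)[x2 [y2 [Fx2 Ry2 xy2]]].
(* The two compactness witnesses may differ; a common lower bound in [F] is related to both [b] and
   [c] by (SI). *)
have [x Fx [xx1 xx2]] := Fdir _ _ Fx1 Fx2.
apply: (@le_trans _ _ (e x)); first by apply: (Meet_le hD); exists x.
by apply: Ru; [apply: SI1 (le_trans xx1 xy1) Ry1|
  apply: SI2 (le_trans xx2 xy2) Ry2].
Qed.

End CanonicalExtensionTheory.

Section GeneratedRelations.
Context (d : Order.disp_t) (A : latticeType d).
Implicit Types (P : set (set (A * A))) (G prec C : set (A * A)).

Lemma smallest_SI P G : P `<=` @SI _ A -> SI (smallest P G).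
Proof. by move=> PSI a b x ab Gb M MP; apply: (PSI M MP.1 _ _ _ ab); apply: Gb. Qed.

Lemma smallest_WO P G : P `<=` @WO _ A -> WO (smallest P G).
Proof.
by move=> PWO b x y Gb xy M MP; apply: (PWO M MP.1 _ _ _ _ xy); apply: Gb.
Qed.

Lemma smallest_OR P G : P `<=` @OR _ A -> OR (smallest P G).
Proof.
by move=> POR a b x Ga Gb M MP; apply: (POR M MP.1); [apply: Ga|apply: Gb].
Qed.

(** The pair [r] found for [X] also serves for [P]. The pairs [p] and [q] lie in the [X]-closure of
    [r], hence in its larger [P]-closure, which then contains everything they generate with
    [prec]. *)
Lemma updirected_sub P X prec C :
  P `<=` X -> updirected X prec C -> updirected P prec C.
Proof.
move=> PX upX p q Cp Cq; have [r Cr pqr] := upX p q Cp Cq; exists r => //.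
have XP : clos_with X prec r `<=` clos_with P prec r.
  by move=> x Xx M [PM GM]; apply: Xx; split=> //; apply: PX.
have gen s : clos_with X prec s s by move=> M [_ GM]; apply: GM; right.
have step s : clos_with X prec s `<=` clos_with X prec r ->
    clos_with P prec s `<=` clos_with P prec r.
  move=> sr; apply: smallest_sub_smallest => x [precx|->].
    by apply: sub_gen_smallest; left.
  by apply: XP; apply: sr; apply: gen.
by move=> x []; apply: step => y ?; apply: pqr; [left|right].
Qed.

Lemma Srel_SI P prec C : P `<=` @SI _ A -> SI (Srel P prec C).
Proof.
move=> PSI a b x ab; rewrite /Srel; case: ifP => _.
  exact: smallest_SI.
by case=> p Cp Sp; exists p => //; apply: (smallest_SI PSI ab).
Qed.

Lemma Srel_WO P prec C : P `<=` @WO _ A -> WO (Srel P prec C).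
Proof.
move=> PWO b x y; rewrite /Srel; case: ifP => _; first exact: smallest_WO.
by case=> p Cp Sp xy; exists p => //; apply: (smallest_WO PWO Sp xy).
Qed.

(** The two premises of (OR) may come from different pairs of [C]; updirectedness moves both into
    one closure. *)
Lemma Srel_OR P prec C :
  P `<=` @OR _ A -> updirected P prec C -> OR (Srel P prec C).
Proof.
move=> POR upP a b x; rewrite /Srel; case: ifP => _; first exact: smallest_OR.
case=> p Cp Sp [q Cq Sq]; have [r Cr pqr] := upP p q Cp Cq.
by exists r => //; apply: (smallest_OR POR); apply: pqr; [left|right].
Qed.

Lemma sub_Srel P prec C : prec `<=` Srel P prec C.
Proof.
move=> x precx; rewrite /Srel; case: ifPn => [_|/set0P[p Cp]].
  exact: sub_gen_smallest.
by exists p => //; apply: sub_gen_smallest; left.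
Qed.

End GeneratedRelations.

Theorem mainTheorem9
  (sg : signature) (V : Type) (L : logic sg V) (hL : selfextensional L)
  (d : Order.disp_t) (A : tbLatticeType d) (op : interp sg A)
  (hAlg : in_Alg L op)
  (hle : forall a b : A, a <= b <-> filter_le L op a b)
  (imp : A -> A -> A) (himp : heyting_imp imp)
  (prec C : set (A * A)) (hsp : sp_algebra prec C)
  (hC : C `<=` compat L op prec)
  (hup : forall X : set (set (A * A)),
     X = @SI _ A \/ X = @WO _ A \/ X = @AND _ A \/ X = @OR _ A ->
     updirected X prec C)
  (d' : Order.disp_t) (D : tbLatticeType d') (e : A -> D)
  (hD : canonical_extension e) :
  let S := Srel (@SI _ A `&` @WO _ A `&` @AND _ A `&` @OR _ A)%classic prec C in
  (forall a b c : A, S (a, b) -> prec (a, c) -> b `&` c <= \bot -> a <= \bot)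
  <->
  (forall c : A, bbox e S (imp c \bot) `&` bbox e prec c <= \bot).
Proof.
move=> S.
have SIS : SI S by apply: Srel_SI => M [[[]]].
have WOS : WO S by apply: Srel_WO => M [[[]]].
have ORS : OR S.
  apply: Srel_OR; first by move=> M [].
  apply: (@updirected_sub _ _ _ (@OR _ A)); first by move=> M [].
  by apply: hup; do 3 right.
have prec0 x : prec (\bot, x) by apply: (prec_WO hsp) (prec_bot hsp) (le0x x).
(* Counit of the adjunction between meet and implication. *)
have impP c : imp c \bot `&` c <= \bot by rewrite himp.
split=> [coh c|box a b c Sab precac bc].
  apply: (bbox_meet_le hD) => //; [exact: prec_SI hsp|exact: prec_OR hsp|
    exact: sub_Srel|].
  move=> a Sa preca; rewrite -(canonical_extension_bot hD) (ce_embed hD).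
  exact: coh Sa preca (impP c).
rewrite -(ce_embed hD) (canonical_extension_bot hD).
apply: le_trans (box c); rewrite lexI; apply/andP; split.
  by apply: (le_bbox hD); apply: WOS Sab _; rewrite -himp.
exact: (le_bbox hD).
Qed.
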